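(* Let $(\mathcal{C},\otimes,1)$ and $(\mathcal{D},\otimes,1')$ be monoidal categories, both having coequalizers and with every object coflat, and let $\varphi:R\to S$ be an algebra morphism in $\mathcal{C}$. Let $(F:\mathcal{C}\to\mathcal{D},\phi^2,\phi^0)$ be a fully faithful, strong monoidal functor, and assume that it preserves coequalizers. If $F(\varphi)^*=-\otimes_{F(R)}F(S):\mathcal{D}_{F(R)}\to\mathcal{D}_{F(S)}$ is semiseparable (resp., separable, naturally full), then $\varphi^*=-\otimes_R S:\mathcal{C}_R\to\mathcal{C}_S$ is semiseparable (resp., separable, naturally full).
   Context: Associativity and unit constraints are suppressed. For an algebra $A$ in a monoidal category $\mathcal{C}$, $m_A$ and $u_A$ are its multiplication and unit, and $\mathcal{C}_A$ (resp. ${}_A\mathcal{C}$) is the category of right (resp. left) $A$-modules in $\mathcal{C}$. An object $X$ is coflat if both $X\otimes-$ and $-\otimes X$ preserve coequalizers. For $M\in\mathcal{C}_A$ with action $\nu$ and $X\in{}_A\mathcal{C}$ with action $\mu$, $q^A_{M,X}:M\otimes X\to M\otimes_A X$ is the coequalizer of $\nu\otimes\mathrm{Id}_X$ and $\mathrm{Id}_M\otimes\mu$. For an algebra morphism $\varphi:R\to S$, $S$ is a left $R$-module via $m_S(\varphi\otimes\mathrm{Id}_S)$, and the induction functor $\varphi^*=-\otimes_R S:\mathcal{C}_R\to\mathcal{C}_S$ sends $X$ to $X\otimes_R S$ with right $S$-action induced by $m_S$, and $f:X\to Y$ to the unique morphism $f\otimes_R S$ with $(f\otimes_R S)q^R_{X,S}=q^R_{Y,S}(f\otimes\mathrm{Id}_S)$.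 A strong monoidal functor $(F,\phi^2,\phi^0)$ is a lax monoidal functor, with structure maps $\phi^2_{X,Y}:F(X)\otimes F(Y)\to F(X\otimes Y)$ (natural) and $\phi^0:1'\to F(1)$ satisfying the usual associativity and unit axioms, such that $\phi^2$ and $\phi^0$ are invertible. It sends an algebra $(R,m_R,u_R)$ to the algebra $(F(R),F(m_R)\phi^2_{R,R},F(u_R)\phi^0)$ and algebra morphisms to algebra morphisms. A functor $F:\mathcal{A}\to\mathcal{B}$ induces the natural transformation $\mathcal{F}:\mathrm{Hom}_{\mathcal{A}}(-,-)\to\mathrm{Hom}_{\mathcal{B}}(F-,F-)$, $f\mapsto F(f)$. $F$ is separable (resp. naturally full, semiseparable) if there is a natural transformation $\mathcal{P}:\mathrm{Hom}_{\mathcal{B}}(F-,F-)\to\mathrm{Hom}_{\mathcal{A}}(-,-)$ with $\mathcal{P}\circ\mathcal{F}=\mathrm{Id}$ (resp. $\mathcal{F}\circ\mathcal{P}=\mathrm{Id}$, $\mathcal{F}\circ\mathcal{P}\circ\mathcal{F}=\mathcal{F}$). *)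

(* Defs.v *)
From Corelib Require Import ssreflect.
From Stdlib Require Import ProofIrrelevance IndefiniteDescription.

Set Implicit Arguments.
Unset Strict Implicit.
Unset Printing Implicit Defensive.
#[local] Obligation Tactic := idtac.

Declare Scope cat_scope.
Delimit Scope cat_scope with cat.
Open Scope cat_scope.

Record Category := {
  Ob :> Type;
  Hom : Ob -> Ob -> Type;
  idm : forall X, Hom X X;
  comp : forall X Y Z, Hom Y Z -> Hom X Y -> Hom X Z;
  compA : forall X Y Z T (h : Hom Z T) (g : Hom Y Z) (f : Hom X Y),
    comp h (comp g f) = comp (comp h g) f;
  comp1m : forall X Y (f : Hom X Y), comp (idm Y) f = f;
  compm1 : forall X Y (f : Hom X Y), comp f (idm X) = f
}.
Arguments Hom {c} _ _.
Arguments idm {c} _.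
Arguments comp {c X Y Z} _ _.

Notation "g ∘ f" := (comp g f) (at level 40, left associativity) : cat_scope.

Record Functor (C D : Category) := {
  fob :> C -> D;
  fmap : forall X Y, Hom X Y -> Hom (fob X) (fob Y);
  fmap_id : forall X, fmap (idm X) = idm (fob X);
  fmap_comp : forall X Y Z (g : Hom Y Z) (f : Hom X Y),
    fmap (g ∘ f) = fmap g ∘ fmap f
}.
Arguments fmap {C D} F {X Y} _ : rename.

Definition is_iso (C : Category) (X Y : C) (f : Hom X Y) : Prop :=
  exists g : Hom Y X, g ∘ f = idm X /\ f ∘ g = idm Y.

Definition faithful (C D : Category) (F : Functor C D) : Prop :=
  forall (X Y : C) (f g : Hom X Y), fmap F f = fmap F g -> f = g.

Definition full (C D : Category) (F : Functor C D) : Prop :=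
  forall (X Y : C) (g : Hom (F X) (F Y)), exists f : Hom X Y, fmap F f = g.

Definition fully_faithful (C D : Category) (F : Functor C D) : Prop :=
  full F /\ faithful F.

Definition is_coequalizer (C : Category) (X Y Q : C) (f g : Hom X Y)
    (q : Hom Y Q) : Prop :=
  q ∘ f = q ∘ g /\
  forall (Z : C) (h : Hom Y Z), h ∘ f = h ∘ g -> exists! u : Hom Q Z, u ∘ q = h.

Record Coequalizer (C : Category) (X Y : C) (f g : Hom X Y) := {
  coeq_ob : C;
  coeq_map : Hom Y coeq_ob;
  coeq_mapP : is_coequalizer f g coeq_map
}.

(* A choice of coequalizers, as the objects M ⊗_A X are built from them. *)
Definition has_coequalizers (C : Category) : Type :=
  forall (X Y : C) (f g : Hom X Y), Coequalizer f g.

Definition preserves_coequalizers (C D : Category) (F : Functor C D) : Prop :=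
  forall (X Y Q : C) (f g : Hom X Y) (q : Hom Y Q),
    is_coequalizer f g q -> is_coequalizer (fmap F f) (fmap F g) (fmap F q).

Section Coequalizers.
Variables (C : Category) (X Y Q : C) (f g : Hom X Y) (q : Hom Y Q).
Hypothesis qP : is_coequalizer f g q.

Lemma coeq_epi (Z : C) (u v : Hom Q Z) : u ∘ q = v ∘ q -> u = v.
Proof.
case: qP => e univ uv.
case: (univ Z (v ∘ q)); first by rewrite -!compA e.
by move=> w [_ uniq]; rewrite -(uniq u) // -(uniq v).
Qed.

Lemma coeq_ex (Z : C) (h : Hom Y Z) :
  h ∘ f = h ∘ g -> exists u : Hom Q Z, u ∘ q = h.
Proof. by move=> /(proj2 qP) [u [uq _]]; exists u. Qed.

Definition coeq_desc (Z : C) (h : Hom Y Z) (e : h ∘ f = h ∘ g) : Hom Q Z :=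
  proj1_sig (constructive_indefinite_description _ (coeq_ex e)).

Lemma coeq_descK (Z : C) (h : Hom Y Z) (e : h ∘ f = h ∘ g) :
  coeq_desc e ∘ q = h.
Proof.
exact: (proj2_sig (constructive_indefinite_description _ (coeq_ex e))).
Qed.

End Coequalizers.

(* Natural transformations Hom_B(F-,F-) -> Hom_A(-,-) between functors
   A^op x A -> Type. *)
Record HomTransf (A B : Category) (F : Functor A B) := {
  htr : forall X Y : A, Hom (F X) (F Y) -> Hom X Y;
  htr_nat : forall (X X' Y Y' : A) (h : Hom X' X) (k : Hom Y Y')
      (g : Hom (F X) (F Y)),
    htr (fmap F k ∘ g ∘ fmap F h) = k ∘ htr g ∘ h
}.
Arguments htr {A B F} _ {X Y} _.

Definition separable (A B : Category) (F : Functor A B) : Prop :=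
  exists P : HomTransf F,
    forall (X Y : A) (f : Hom X Y), htr P (fmap F f) = f.

Definition naturally_full (A B : Category) (F : Functor A B) : Prop :=
  exists P : HomTransf F,
    forall (X Y : A) (g : Hom (F X) (F Y)), fmap F (htr P g) = g.

Definition semiseparable (A B : Category) (F : Functor A B) : Prop :=
  exists P : HomTransf F,
    forall (X Y : A) (f : Hom X Y), fmap F (htr P (fmap F f)) = fmap F f.

(* The tensor product is written ⊗ on objects and ⊠ on morphisms. *)
Record MonoidalCategory := {
  mcat :> Category;
  tens : mcat -> mcat -> mcat;
  tensm : forall X X' Y Y' : mcat,
    Hom X X' -> Hom Y Y' -> Hom (tens X Y) (tens X' Y');
  munit : mcat;
  assoc : forall X Y Z, Hom (tens (tens X Y) Z) (tens X (tens Y Z));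
  lunit : forall X, Hom (tens munit X) X;
  runit : forall X, Hom (tens X munit) X;
  tensm_id : forall X Y, tensm (idm X) (idm Y) = idm (tens X Y);
  tensm_comp : forall X X' X'' Y Y' Y'' (f' : Hom X' X'') (f : Hom X X')
      (g' : Hom Y' Y'') (g : Hom Y Y'),
    tensm (f' ∘ f) (g' ∘ g) = tensm f' g' ∘ tensm f g;
  assoc_iso : forall X Y Z, is_iso (assoc X Y Z);
  lunit_iso : forall X, is_iso (lunit X);
  runit_iso : forall X, is_iso (runit X);
  assoc_nat : forall X X' Y Y' Z Z' (f : Hom X X') (g : Hom Y Y') (h : Hom Z Z'),
    assoc X' Y' Z' ∘ tensm (tensm f g) h = tensm f (tensm g h) ∘ assoc X Y Z;
  lunit_nat : forall X X' (f : Hom X X'),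
    lunit X' ∘ tensm (idm munit) f = f ∘ lunit X;
  runit_nat : forall X X' (f : Hom X X'),
    runit X' ∘ tensm f (idm munit) = f ∘ runit X;
  pentagon : forall X Y Z T,
    assoc X Y (tens Z T) ∘ assoc (tens X Y) Z T
    = tensm (idm X) (assoc Y Z T) ∘ assoc X (tens Y Z) T
      ∘ tensm (assoc X Y Z) (idm T);
  triangle : forall X Y,
    tensm (idm X) (lunit Y) ∘ assoc X munit Y = tensm (runit X) (idm Y)
}.
Arguments tens {m} _ _.
Arguments tensm {m X X' Y Y'} _ _.
Arguments munit {m}.
Arguments assoc {m} _ _ _.
Arguments lunit {m} _.
Arguments runit {m} _.

Notation "X ⊗ Y" := (tens X Y) (at level 30, right associativity) : cat_scope.
Notation "f ⊠ g" := (tensm f g) (at level 30, right associativity) : cat_scope.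

Section TensorFunctors.
Variables (C : MonoidalCategory) (X : C).

Program Definition tensor_left : Functor C C :=
  {| fob := fun Y => X ⊗ Y; fmap := fun Y Z f => idm X ⊠ f |}.
Next Obligation. by move=> Y /=; rewrite tensm_id. Qed.
Next Obligation. by move=> Y Z T g f /=; rewrite -tensm_comp comp1m. Qed.

Program Definition tensor_right : Functor C C :=
  {| fob := fun Y => Y ⊗ X; fmap := fun Y Z f => f ⊠ idm X |}.
Next Obligation. by move=> Y /=; rewrite tensm_id. Qed.
Next Obligation. by move=> Y Z T g f /=; rewrite -tensm_comp comp1m. Qed.

Definition coflat : Prop :=
  preserves_coequalizers tensor_left /\ preserves_coequalizers tensor_right.

End TensorFunctors.

Section MonoidalLemmas.
Variable C : MonoidalCategory.
Implicit Types X Y Z : C.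

Lemma tens_comp1 X X' X'' Y (g : Hom X' X'') (f : Hom X X') :
  (g ∘ f) ⊠ idm Y = (g ⊠ idm Y) ∘ (f ⊠ idm Y).
Proof. by rewrite -tensm_comp comp1m. Qed.

Lemma tens_1comp X X' X'' Y (g : Hom X' X'') (f : Hom X X') :
  idm Y ⊠ (g ∘ f) = (idm Y ⊠ g) ∘ (idm Y ⊠ f).
Proof. by rewrite -tensm_comp comp1m. Qed.

Lemma tens_swap X X' Y Y' (f : Hom X X') (g : Hom Y Y') :
  (f ⊠ idm Y') ∘ (idm X ⊠ g) = (idm X' ⊠ g) ∘ (f ⊠ idm Y).
Proof. by rewrite -!tensm_comp !comp1m !compm1. Qed.

Lemma assoc_nat1 X X' Y Z (f : Hom X X') :
  assoc X' Y Z ∘ ((f ⊠ idm Y) ⊠ idm Z) = (f ⊠ idm (Y ⊗ Z)) ∘ assoc X Y Z.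
Proof. by rewrite assoc_nat tensm_id. Qed.

Lemma assoc_nat3 X Y Z Z' (h : Hom Z Z') :
  assoc X Y Z' ∘ (idm (X ⊗ Y) ⊠ h) = (idm X ⊠ (idm Y ⊠ h)) ∘ assoc X Y Z.
Proof. by rewrite -assoc_nat tensm_id. Qed.

Lemma iso_epi X Y Z (e : Hom X Y) (u v : Hom Y Z) :
  is_iso e -> u ∘ e = v ∘ e -> u = v.
Proof.
move=> [e' [_ ee']] uv.
by rewrite -(compm1 u) -(compm1 v) -ee' !compA uv.
Qed.

Lemma iso_mono X Y Z (e : Hom Y Z) (u v : Hom X Y) :
  is_iso e -> e ∘ u = e ∘ v -> u = v.
Proof.
move=> [e' [e'e _]] uv.
by rewrite -(comp1m u) -(comp1m v) -e'e -!compA uv.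
Qed.

Lemma runit_tens X Y : (idm X ⊠ runit Y) ∘ assoc X Y munit = runit (X ⊗ Y).
Proof.
suff e : ((idm X ⊠ runit Y) ∘ assoc X Y munit) ⊠ idm munit
         = runit (X ⊗ Y) ⊠ idm munit.
  apply: (iso_epi (runit_iso _)).
  by rewrite -2!runit_nat e.
apply: (iso_mono (assoc_iso _ _ _)).
rewrite tens_comp1 compA assoc_nat -(triangle Y) -(triangle (X ⊗ Y)).
rewrite tens_1comp compA assoc_nat3.
by rewrite -!compA; congr (_ ∘ _); rewrite compA -pentagon.
Qed.

End MonoidalLemmas.

Record Algebra (C : MonoidalCategory) := {
  acar :> C;
  mul : Hom (acar ⊗ acar) acar;
  one : Hom munit acar;
  mul_assoc : mul ∘ (mul ⊠ idm acar)
              = mul ∘ (idm acar ⊠ mul) ∘ assoc acar acar acar;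
  mul_1l : mul ∘ (one ⊠ idm acar) = lunit acar;
  mul_1r : mul ∘ (idm acar ⊠ one) = runit acar
}.
Arguments mul {C} A : rename.
Arguments one {C} A : rename.

Record AlgebraHom (C : MonoidalCategory) (A B : Algebra C) := {
  ahom :> Hom (acar A) (acar B);
  ahom_mul : ahom ∘ mul A = mul B ∘ (ahom ⊠ ahom);
  ahom_one : ahom ∘ one A = one B
}.

Record RightModule (C : MonoidalCategory) (A : Algebra C) := {
  rcar :> C;
  ract : Hom (rcar ⊗ A) rcar;
  ract_mul : ract ∘ (ract ⊠ idm A)
             = ract ∘ (idm rcar ⊠ mul A) ∘ assoc rcar A A;
  ract_one : ract ∘ (idm rcar ⊠ one A) = runit rcar
}.
Arguments ract {C A} M : rename.

Record LeftModule (C : MonoidalCategory) (A : Algebra C) := {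
  lcar :> C;
  lact : Hom (A ⊗ lcar) lcar;
  lact_mul : lact ∘ (mul A ⊠ idm lcar)
             = lact ∘ (idm A ⊠ lact) ∘ assoc A A lcar;
  lact_one : lact ∘ (one A ⊠ idm lcar) = lunit lcar
}.
Arguments lact {C A} M : rename.

Record RightModuleHom (C : MonoidalCategory) (A : Algebra C)
    (M N : RightModule A) := {
  rhom :> Hom (rcar M) (rcar N);
  rhom_act : rhom ∘ ract M = ract N ∘ (rhom ⊠ idm A)
}.

Lemma rhom_inj (C : MonoidalCategory) (A : Algebra C) (M N : RightModule A)
  (f g : RightModuleHom M N) : rhom f = rhom g -> f = g.
Proof.
case: f g => f pf [g pg] /= e; case: g / e pg => pg.
by rewrite (proof_irrelevance _ pf pg).
Qed.

Section RightModuleCategory.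
Variables (C : MonoidalCategory) (A : Algebra C).

Program Definition rmod_id (M : RightModule A) : RightModuleHom M M :=
  {| rhom := idm (rcar M) |}.
Next Obligation. by move=> M /=; rewrite tensm_id comp1m compm1. Qed.

Program Definition rmod_comp (M N P : RightModule A) (g : RightModuleHom N P)
    (f : RightModuleHom M N) : RightModuleHom M P :=
  {| rhom := rhom g ∘ rhom f |}.
Next Obligation.
by move=> M N P g f /=; rewrite tens_comp1 compA -rhom_act -!compA rhom_act.
Qed.

Program Definition RightModCat : Category :=
  {| Ob := RightModule A; Hom := @RightModuleHom C A;
     idm := rmod_id; comp := rmod_comp |}.
Next Obligation. by move=> *; apply: rhom_inj; apply: compA. Qed.
Next Obligation. by move=> *; apply: rhom_inj; apply: comp1m. Qed.
Next Obligation. by move=> *; apply: rhom_inj; apply: compm1. Qed.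

End RightModuleCategory.

Section TensorOver.
Variables (C : MonoidalCategory) (coeqC : has_coequalizers C) (A : Algebra C).

Definition tens_over_coeq (M : RightModule A) (X : LeftModule A) :
  Coequalizer (ract M ⊠ idm (lcar X))
              ((idm (rcar M) ⊠ lact X) ∘ assoc (rcar M) A (lcar X)) :=
  coeqC _ _.

Definition tens_over (M : RightModule A) (X : LeftModule A) : C :=
  coeq_ob (tens_over_coeq M X).

Definition tens_over_map (M : RightModule A) (X : LeftModule A) :
  Hom (rcar M ⊗ lcar X) (tens_over M X) := coeq_map (tens_over_coeq M X).

Lemma tens_over_mapP (M : RightModule A) (X : LeftModule A) :
  is_coequalizer (ract M ⊠ idm (lcar X))
    ((idm (rcar M) ⊠ lact X) ∘ assoc (rcar M) A (lcar X)) (tens_over_map M X).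
Proof. exact: coeq_mapP. Qed.

Lemma tens_over_hom_compat (M N : RightModule A) (X : LeftModule A)
    (f : RightModuleHom M N) :
  (tens_over_map N X ∘ (rhom f ⊠ idm (lcar X))) ∘ (ract M ⊠ idm (lcar X))
  = (tens_over_map N X ∘ (rhom f ⊠ idm (lcar X)))
    ∘ ((idm (rcar M) ⊠ lact X) ∘ assoc (rcar M) A (lcar X)).
Proof.
rewrite -compA -tens_comp1 rhom_act tens_comp1 compA.
rewrite (proj1 (tens_over_mapP N X)) -!compA; congr (_ ∘ _).
by rewrite assoc_nat1 !compA tens_swap.
Qed.

Definition tens_over_hom (M N : RightModule A) (X : LeftModule A)
    (f : RightModuleHom M N) : Hom (tens_over M X) (tens_over N X) :=
  coeq_desc (tens_over_mapP M X) (tens_over_hom_compat X f).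

Lemma tens_over_homE (M N : RightModule A) (X : LeftModule A)
    (f : RightModuleHom M N) :
  tens_over_hom X f ∘ tens_over_map M X
  = tens_over_map N X ∘ (rhom f ⊠ idm (lcar X)).
Proof. exact: coeq_descK. Qed.

End TensorOver.

(* S as a left R-module, with action m_S (phi ⊗ Id_S). *)
Program Definition restr_left (C : MonoidalCategory) (R S : Algebra C)
    (phi : AlgebraHom R S) : LeftModule R :=
  {| lcar := acar S; lact := mul S ∘ (ahom phi ⊠ idm (acar S)) |}.
Next Obligation.
move=> C R S phi /=.
rewrite -compA -tens_comp1 ahom_mul tens_comp1 compA mul_assoc.
rewrite -!compA; congr (_ ∘ _).
rewrite assoc_nat !compA; congr (_ ∘ _).
by rewrite -!tensm_comp !comp1m !compm1.
Qed.
Next Obligation.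
by move=> C R S phi /=; rewrite -compA -tens_comp1 ahom_one mul_1l.
Qed.

Section Induction.
Variables (C : MonoidalCategory) (coeqC : has_coequalizers C).
Variables (R S : Algebra C) (phi : AlgebraHom R S).
Hypothesis coflatS : coflat (acar S).

Definition ind_car (M : RightModule R) : C :=
  tens_over coeqC M (restr_left phi).

Definition ind_map (M : RightModule R) : Hom (rcar M ⊗ acar S) (ind_car M) :=
  tens_over_map coeqC M (restr_left phi).

Definition ind_lact : Hom (acar R ⊗ acar S) (acar S) :=
  mul S ∘ (ahom phi ⊠ idm (acar S)).

Lemma ind_mapP (M : RightModule R) :
  is_coequalizer (ract M ⊠ idm (acar S))
    ((idm (rcar M) ⊠ ind_lact) ∘ assoc (rcar M) (acar R) (acar S)) (ind_map M).
Proof. exact: (tens_over_mapP coeqC M (restr_left phi)). Qed.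

Lemma ind_map_tensP (M : RightModule R) :
  is_coequalizer ((ract M ⊠ idm (acar S)) ⊠ idm (acar S))
    (((idm (rcar M) ⊠ ind_lact) ∘ assoc (rcar M) (acar R) (acar S))
       ⊠ idm (acar S))
    (ind_map M ⊠ idm (acar S)).
Proof. exact: (proj2 coflatS _ _ _ _ _ _ (ind_mapP M)). Qed.

Lemma ind_map_tens_epi (M : RightModule R) (Z : C)
    (u v : Hom (ind_car M ⊗ acar S) Z) :
  u ∘ (ind_map M ⊠ idm (acar S)) = v ∘ (ind_map M ⊠ idm (acar S)) -> u = v.
Proof. exact: (coeq_epi (ind_map_tensP M)). Qed.

Lemma ind_map_tens2_epi (M : RightModule R) (Z : C)
    (u v : Hom ((ind_car M ⊗ acar S) ⊗ acar S) Z) :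
  u ∘ ((ind_map M ⊠ idm (acar S)) ⊠ idm (acar S))
  = v ∘ ((ind_map M ⊠ idm (acar S)) ⊠ idm (acar S)) -> u = v.
Proof. exact: (coeq_epi (proj2 coflatS _ _ _ _ _ _ (ind_map_tensP M))). Qed.

Lemma ind_lact_mul :
  ind_lact ∘ (idm (acar R) ⊠ mul S) ∘ assoc (acar R) S S
  = mul S ∘ (ind_lact ⊠ idm (acar S)).
Proof.
rewrite /ind_lact tens_comp1 compA mul_assoc -!compA; congr (_ ∘ _).
by rewrite assoc_nat1 !compA tens_swap.
Qed.

Lemma ind_act_compat (M : RightModule R) :
  (ind_map M ∘ ((idm (rcar M) ⊠ mul S) ∘ assoc (rcar M) S S))
    ∘ ((ract M ⊠ idm (acar S)) ⊠ idm (acar S))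
  = (ind_map M ∘ ((idm (rcar M) ⊠ mul S) ∘ assoc (rcar M) S S))
    ∘ (((idm (rcar M) ⊠ ind_lact) ∘ assoc (rcar M) (acar R) (acar S))
         ⊠ idm (acar S)).
Proof.
rewrite -!compA assoc_nat1 (compA (_ ⊠ mul S) (ract M ⊠ _)) -tens_swap.
rewrite !compA (proj1 (ind_mapP M)).
rewrite -!compA; congr (_ ∘ _).
rewrite (compA (assoc _ R S)) assoc_nat3 tens_comp1.
rewrite (compA (assoc _ S S)) assoc_nat.
rewrite -!compA pentagon !compA; congr (_ ∘ _); congr (_ ∘ _).
rewrite -!tens_1comp; congr (_ ⊠ _).
exact: ind_lact_mul.
Qed.

(* As S is coflat, q ⊗ S is a coequalizer (q = ind_map M), so m_S induces a right
   S-action on M ⊗_R S. *)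
Definition ind_act (M : RightModule R) : Hom (ind_car M ⊗ acar S) (ind_car M) :=
  coeq_desc (ind_map_tensP M) (ind_act_compat M).

Lemma ind_actE (M : RightModule R) :
  ind_act M ∘ (ind_map M ⊠ idm (acar S))
  = ind_map M ∘ ((idm (rcar M) ⊠ mul S) ∘ assoc (rcar M) S S).
Proof. exact: (coeq_descK (ind_map_tensP M)). Qed.

Lemma ind_act_mul (M : RightModule R) :
  ind_act M ∘ (ind_act M ⊠ idm (acar S))
  = ind_act M ∘ (idm (ind_car M) ⊠ mul S) ∘ assoc (ind_car M) S S.
Proof.
apply: ind_map_tens2_epi.
rewrite -!compA -tens_comp1 ind_actE tens_comp1 (compA (ind_act M)) ind_actE.
rewrite assoc_nat1 (compA (_ ⊠ mul S)) -tens_swap !compA ind_actE.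
rewrite -!compA; congr (_ ∘ _).
rewrite tens_comp1 (compA (assoc _ S S)) assoc_nat.
rewrite (compA (assoc _ S S) (idm _ ⊠ _)) assoc_nat3 -!compA pentagon !compA.
congr (_ ∘ _); congr (_ ∘ _).
by rewrite -!tens_1comp mul_assoc.
Qed.

Lemma ind_act_one (M : RightModule R) :
  ind_act M ∘ (idm (ind_car M) ⊠ one S) = runit (ind_car M).
Proof.
have epi : forall (Z : C) (u v : Hom (ind_car M ⊗ munit) Z),
    u ∘ (ind_map M ⊠ idm munit) = v ∘ (ind_map M ⊠ idm munit) -> u = v.
  move=> Z u v e.
  have [r [rk kr]] := runit_iso (ind_car M).
  have ur : u ∘ r = v ∘ r.
    apply: (coeq_epi (ind_mapP M)); apply: (iso_epi (runit_iso _)).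
    by rewrite -!compA -runit_nat !(compA r) rk !comp1m.
  by rewrite -(compm1 u) -(compm1 v) -rk !compA ur.
apply: epi; rewrite runit_nat.
rewrite -compA -tens_swap compA ind_actE -!compA; congr (_ ∘ _).
by rewrite assoc_nat3 compA -tens_1comp mul_1r runit_tens.
Qed.

Definition ind_ob (M : RightModule R) : RightModule S :=
  {| rcar := ind_car M; ract := ind_act M;
     ract_mul := ind_act_mul M; ract_one := ind_act_one M |}.

Definition ind_hom (M N : RightModule R) (f : RightModuleHom M N) :
  Hom (ind_car M) (ind_car N) := tens_over_hom coeqC (restr_left phi) f.

Lemma ind_homE (M N : RightModule R) (f : RightModuleHom M N) :
  ind_hom f ∘ ind_map M = ind_map N ∘ (rhom f ⊠ idm (acar S)).
Proof. exact: (tens_over_homE coeqC (restr_left phi) f). Qed.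

Lemma ind_hom_act (M N : RightModule R) (f : RightModuleHom M N) :
  ind_hom f ∘ ind_act M = ind_act N ∘ (ind_hom f ⊠ idm (acar S)).
Proof.
apply: ind_map_tens_epi.
rewrite -!compA -tens_comp1 ind_homE ind_actE tens_comp1 !compA ind_homE.
rewrite ind_actE -!compA; congr (_ ∘ _).
by rewrite assoc_nat1 !compA tens_swap.
Qed.

Definition ind_fmap (M N : RightModule R) (f : RightModuleHom M N) :
  RightModuleHom (ind_ob M) (ind_ob N) :=
  {| rhom := ind_hom f : Hom (rcar (ind_ob M)) (rcar (ind_ob N));
     rhom_act := ind_hom_act f |}.

Program Definition induction : Functor (RightModCat R) (RightModCat S) :=
  {| fob := ind_ob : RightModCat R -> RightModCat S; fmap := ind_fmap |}.
Next Obligation.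
move=> M; apply: rhom_inj; apply: (coeq_epi (ind_mapP M)).
by rewrite [LHS]ind_homE tensm_id compm1 comp1m.
Qed.
Next Obligation.
move=> M N P g f; apply: rhom_inj; apply: (coeq_epi (ind_mapP M)).
rewrite [LHS]ind_homE /= -compA ind_homE compA ind_homE -compA.
by rewrite -tens_comp1.
Qed.

End Induction.

Record StrongMonoidalFunctor (C D : MonoidalCategory) := {
  mfun :> Functor C D;
  phi2 : forall X Y : C, Hom (mfun X ⊗ mfun Y) (mfun (X ⊗ Y));
  phi0 : Hom (munit : D) (mfun munit);
  phi2_nat : forall (X X' Y Y' : C) (f : Hom X X') (g : Hom Y Y'),
    phi2 X' Y' ∘ (fmap mfun f ⊠ fmap mfun g) = fmap mfun (f ⊠ g) ∘ phi2 X Y;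
  phi2_assoc : forall X Y Z : C,
    fmap mfun (assoc X Y Z) ∘ phi2 (X ⊗ Y) Z ∘ (phi2 X Y ⊠ idm (mfun Z))
    = phi2 X (Y ⊗ Z) ∘ (idm (mfun X) ⊠ phi2 Y Z)
      ∘ assoc (mfun X) (mfun Y) (mfun Z);
  phi2_lunit : forall X : C,
    fmap mfun (lunit X) ∘ phi2 munit X ∘ (phi0 ⊠ idm (mfun X)) = lunit (mfun X);
  phi2_runit : forall X : C,
    fmap mfun (runit X) ∘ phi2 X munit ∘ (idm (mfun X) ⊠ phi0) = runit (mfun X);
  phi2_iso : forall X Y : C, is_iso (phi2 X Y);
  phi0_iso : is_iso phi0
}.
Arguments phi2 {C D} F X Y : rename.
Arguments phi0 {C D} F : rename.

Section MapAlgebra.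
Variables (C D : MonoidalCategory) (F : StrongMonoidalFunctor C D).

Lemma phi2_nat1 (X X' Y : C) (f : Hom X X') :
  phi2 F X' Y ∘ (fmap F f ⊠ idm (F Y)) = fmap F (f ⊠ idm Y) ∘ phi2 F X Y.
Proof. by rewrite -fmap_id phi2_nat. Qed.

Lemma phi2_nat2 (X Y Y' : C) (g : Hom Y Y') :
  phi2 F X Y' ∘ (idm (F X) ⊠ fmap F g) = fmap F (idm X ⊠ g) ∘ phi2 F X Y.
Proof. by rewrite -fmap_id phi2_nat. Qed.

Program Definition map_alg (A : Algebra C) : Algebra D :=
  {| acar := F (acar A);
     mul := fmap F (mul A) ∘ phi2 F (acar A) (acar A);
     one := fmap F (one A) ∘ phi0 F |}.
Next Obligation.
move=> A /=.
rewrite tens_comp1 compA -(compA (fmap F (mul A))) phi2_nat1 compA -fmap_comp.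
rewrite mul_assoc !fmap_comp -!compA; congr (_ ∘ _).
rewrite (compA (fmap F (assoc _ _ _))) phi2_assoc.
by rewrite !compA -phi2_nat2 tens_1comp compA.
Qed.
Next Obligation.
move=> A /=.
rewrite tens_comp1 compA -(compA (fmap F (mul A))) phi2_nat1 compA -fmap_comp.
by rewrite mul_1l phi2_lunit.
Qed.
Next Obligation.
move=> A /=.
rewrite tens_1comp compA -(compA (fmap F (mul A))) phi2_nat2 compA -fmap_comp.
by rewrite mul_1r phi2_runit.
Qed.

Program Definition map_alg_hom (A B : Algebra C) (f : AlgebraHom A B) :
    AlgebraHom (map_alg A) (map_alg B) :=
  {| ahom := fmap F (ahom f) : Hom (acar (map_alg A)) (acar (map_alg B)) |}.
Next Obligation.
move=> A B f /=.
by rewrite compA -fmap_comp ahom_mul fmap_comp -!compA phi2_nat.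
Qed.
Next Obligation.
by move=> A B f /=; rewrite compA -fmap_comp ahom_one.
Qed.

End MapAlgebra.

(* Main.v *)
(** A strong monoidal [F] lifts to functors [H] on right [R]-modules and [K] on
right [S]-modules, fully faithful when [F] is. As [F] preserves coequalizers,
[F(M ⊗_R S)] is, up to [phi2], the coequalizer defining [F(M) ⊗_{F(R)} F(S)],
whence an isomorphism [θ] of [F(φ)^* ∘ H] with [K ∘ φ^*]. A transformation [P]
for [F(φ)^*] then gives [g ↦ H^{-1} (P (θ^{-1} ∘ K g ∘ θ))] for [φ^*]. *)

From Corelib Require Import ssreflect.
From Stdlib Require Import IndefiniteDescription.
Require Import Defs.

Set Implicit Arguments.
Unset Strict Implicit.
Unset Printing Implicit Defensive.
#[local] Obligation Tactic := idtac.

(** * Transfer along a square of functors commuting up to natural isomorphism *)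

Section Transfer.
Variables (A B A' B' : Category).
Variables (G : Functor A B) (G' : Functor A' B').
Variables (H : Functor A A') (K : Functor B B').
Hypotheses (H_ff : fully_faithful H) (K_faithful : faithful K).
Variables (theta : forall X : A, Hom (G' (H X)) (K (G X)))
          (theta' : forall X : A, Hom (K (G X)) (G' (H X))).
Hypotheses (thetaK : forall X, theta' X ∘ theta X = idm _)
           (theta'K : forall X, theta X ∘ theta' X = idm _).
Hypothesis theta_nat : forall (X Y : A) (f : Hom X Y),
  theta Y ∘ fmap G' (fmap H f) = fmap K (fmap G f) ∘ theta X.

(** Fullness only asserts existence, so a preimage under [H] is chosen; faithfulness of [H] makes it
    unique, hence compatible with composition. *)
Definition ff_preimage (X Y : A) (g : Hom (H X) (H Y)) : Hom X Y :=
  proj1_sig (constructive_indefinite_description _ (proj1 H_ff X Y g)).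

Lemma ff_preimageK (X Y : A) (g : Hom (H X) (H Y)) :
  fmap H (ff_preimage g) = g.
Proof.
exact: (proj2_sig (constructive_indefinite_description _ (proj1 H_ff X Y g))).
Qed.

Definition theta_conj (X Y : A) (g : Hom (G X) (G Y)) :
  Hom (G' (H X)) (G' (H Y)) := theta' Y ∘ fmap K g ∘ theta X.

Lemma theta_conj_fmap (X Y : A) (f : Hom X Y) :
  theta_conj (fmap G f) = fmap G' (fmap H f).
Proof. by rewrite /theta_conj -compA -theta_nat compA thetaK comp1m. Qed.

(** Conjugating back by [theta] recovers [fmap K g], and [K] is faithful. Equations between
    morphisms in the image of [G] can thus be checked on the side of [G']. *)
Lemma theta_conj_inj (X Y : A) (g h : Hom (G X) (G Y)) :
  theta_conj g = theta_conj h -> g = h.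
Proof.
have conjK (k : Hom (G X) (G Y)) : theta Y ∘ theta_conj k ∘ theta' X = fmap K k.
  by rewrite /theta_conj -!compA theta'K compm1 compA theta'K comp1m.
by move=> e; apply: K_faithful; rewrite -!conjK e.
Qed.

(** The inner pairs [theta X ∘ theta' X] cancel; this yields the naturality of the transferred
    transformation. *)
Lemma theta_conj_comp (X X' Y Y' : A) (h : Hom X' X) (k : Hom Y Y')
    (g : Hom (G X) (G Y)) :
  theta_conj (fmap G k ∘ g ∘ fmap G h)
  = fmap G' (fmap H k) ∘ theta_conj g ∘ fmap G' (fmap H h).
Proof.
rewrite -!theta_conj_fmap /theta_conj !fmap_comp -!compA.
by rewrite !(compA (theta _) (theta' _)) !theta'K !comp1m.
Qed.

Program Definition transfer (P : HomTransf G') : HomTransf G :=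
  {| htr := fun X Y g => ff_preimage (htr P (theta_conj g)) |}.
Next Obligation.
move=> P X X' Y Y' h k g; apply: (proj2 H_ff).
by rewrite !fmap_comp !ff_preimageK theta_conj_comp htr_nat.
Qed.

Lemma semiseparable_transfer : semiseparable G' -> semiseparable G.
Proof.
move=> [P PP]; exists (transfer P) => X Y f; apply: theta_conj_inj.
by rewrite !theta_conj_fmap ff_preimageK theta_conj_fmap PP.
Qed.

Lemma separable_transfer : separable G' -> separable G.
Proof.
(* The required equation lives in [A], so it is tested through [H] instead of [theta_conj]. *)
move=> [P PP]; exists (transfer P) => X Y f; apply: (proj2 H_ff).
by rewrite ff_preimageK theta_conj_fmap PP.
Qed.

Lemma naturally_full_transfer : naturally_full G' -> naturally_full G.
Proof.
move=> [P PP]; exists (transfer P) => X Y g; apply: theta_conj_inj.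
by rewrite theta_conj_fmap ff_preimageK PP.
Qed.

End Transfer.

(** * Coequalizers up to isomorphism *)

Section CoequalizerIso.
Variable C : Category.

(** Since [d] is epi, [h] equalizes [f'] and [g'] exactly when [h ∘ e'] equalizes [f] and [g], where
    [e'] is the inverse of [e]; factorizations through [q ∘ e] and through [q] then correspond. *)
Lemma coequalizer_reindex (X X' Y Y' Q : C) (f g : Hom X Y) (f' g' : Hom X' Y')
    (q : Hom Y Q) (d : Hom X' X) (e : Hom Y' Y) :
  (forall (Z : C) (u v : Hom X Z), u ∘ d = v ∘ d -> u = v) -> is_iso e ->
  e ∘ f' = f ∘ d -> e ∘ g' = g ∘ d ->
  is_coequalizer f g q -> is_coequalizer f' g' (q ∘ e).
Proof.
move=> d_epi [e' [e'e ee']] ef eg [qfg univ]; split.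
  by rewrite -!compA ef eg !compA qfg.
move=> Z h hfg.
have [u [uq uniq]] : exists! u, u ∘ q = h ∘ e'.
  apply: univ; apply: d_epi.
  by rewrite -!compA -ef -eg !(compA e') e'e !comp1m.
exists u; split; first by rewrite compA uq -compA e'e compm1.
by move=> v vqe; apply: uniq; rewrite -vqe -!compA ee' compm1.
Qed.

Lemma coequalizer_iso (X Y Q Q' : C) (f g : Hom X Y) (q : Hom Y Q)
    (q' : Hom Y Q') (u : Hom Q Q') :
  is_coequalizer f g q -> is_coequalizer f g q' -> u ∘ q = q' -> is_iso u.
Proof.
move=> qP q'P uq; have [v vq'] := coeq_ex q'P (proj1 qP).
exists v; split.
  by apply: (coeq_epi qP); rewrite -compA uq vq' comp1m.
by apply: (coeq_epi q'P); rewrite -compA vq' uq comp1m.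
Qed.

End CoequalizerIso.

(** * Isomorphisms of objects and of modules *)

Lemma is_iso_comp (C : Category) (X Y Z : C) (g : Hom Y Z) (f : Hom X Y) :
  is_iso g -> is_iso f -> is_iso (g ∘ f).
Proof.
move=> [g' [g'g gg']] [f' [f'f ff']]; exists (f' ∘ g'); split.
  by rewrite -compA (compA g') g'g comp1m.
by rewrite -compA (compA f) ff' comp1m.
Qed.

Lemma is_iso_tens1 (C : MonoidalCategory) (X Y Z : C) (f : Hom X Y) :
  is_iso f -> is_iso (f ⊠ idm Z).
Proof.
move=> [g [gf fg]]; exists (g ⊠ idm Z).
by rewrite -!tens_comp1 gf fg !tensm_id.
Qed.

(** The inverse of a bijective linear map is linear: this can be tested after precomposition with
    the isomorphism [rhom f ⊠ idm A]. *)
Lemma rmod_is_iso (C : MonoidalCategory) (A : Algebra C)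
    (M N : RightModCat A) (f : Hom M N) :
  is_iso (rhom f) -> is_iso f.
Proof.
move=> [g [gf fg]].
have g_act : g ∘ ract N = ract M ∘ (g ⊠ idm (acar A)).
  apply: (iso_epi (is_iso_tens1 (acar A) (f := rhom f) _)).
    by exists g.
  rewrite -!compA -rhom_act -tens_comp1 compA gf tensm_id.
  by rewrite comp1m compm1.
by exists (Build_RightModuleHom g_act : Hom N M); split; apply: rhom_inj.
Qed.

(** * The functor induced by [F] on right modules *)

Section MapModule.
Variables (C D : MonoidalCategory) (F : StrongMonoidalFunctor C D).
Variable A : Algebra C.

Program Definition map_rmod (M : RightModule A) : RightModule (map_alg F A) :=
  {| rcar := F (rcar M); ract := fmap F (ract M) ∘ phi2 F (rcar M) (acar A) |}.
Next Obligation.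
move=> M /=.
rewrite tens_comp1 compA -(compA (fmap F (ract M))) phi2_nat1 compA -fmap_comp.
rewrite ract_mul !fmap_comp -!compA; congr (_ ∘ _).
rewrite (compA (fmap F (assoc _ _ _))) phi2_assoc.
by rewrite !compA -phi2_nat2 tens_1comp compA.
Qed.
Next Obligation.
move=> M /=.
rewrite tens_1comp compA -(compA (fmap F (ract M))) phi2_nat2 compA -fmap_comp.
by rewrite ract_one phi2_runit.
Qed.

Program Definition map_rmod_hom (M N : RightModule A) (f : RightModuleHom M N) :
    RightModuleHom (map_rmod M) (map_rmod N) :=
  {| rhom := fmap F (rhom f) : Hom (rcar (map_rmod M)) (rcar (map_rmod N)) |}.
Next Obligation.
move=> M N f /=.
by rewrite compA -fmap_comp rhom_act fmap_comp -!compA phi2_nat1.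
Qed.

Program Definition map_rmod_functor :
    Functor (RightModCat A) (RightModCat (map_alg F A)) :=
  {| fob := map_rmod : RightModCat A -> RightModCat (map_alg F A);
     fmap := map_rmod_hom |}.
Next Obligation. by move=> M; apply: rhom_inj; apply: fmap_id. Qed.
Next Obligation. by move=> *; apply: rhom_inj; apply: fmap_comp. Qed.

Lemma map_rmod_faithful : faithful F -> faithful map_rmod_functor.
Proof.
move=> F_faithful M N f g e; apply: rhom_inj; apply: F_faithful.
exact: (f_equal (fun h : RightModuleHom _ _ => rhom h) e).
Qed.

Lemma map_rmod_ff : fully_faithful F -> fully_faithful map_rmod_functor.
Proof.
move=> [F_full F_faithful]; split; last exact: map_rmod_faithful.
move=> M N g; have [f fg] := F_full _ _ (rhom g).
(* The preimage of a linear map is linear: apply [F], then cancel the invertible [phi2], which turns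
   the claim into linearity of [g]. *)
have f_act : f ∘ ract M = ract N ∘ (f ⊠ idm (acar A)).
  apply: F_faithful; apply: (iso_epi (phi2_iso F _ _)).
  have := rhom_act g; rewrite /= -fg => e.
  by rewrite !fmap_comp -!compA e -compA phi2_nat1.
by exists (Build_RightModuleHom f_act : Hom M N); apply: rhom_inj.
Qed.

End MapModule.

(** * Comparison of [F] after induction with induction after [F] *)

Section InductionComparison.
Variables (C D : MonoidalCategory).
Variables (coeqC : has_coequalizers C) (coeqD : has_coequalizers D).
Variables (R S : Algebra C) (phi : AlgebraHom R S).
Variable F : StrongMonoidalFunctor C D.
Hypothesis F_coeq : preserves_coequalizers F.
Hypotheses (coflatS : coflat (acar S)) (coflatFS : coflat (acar (map_alg F S))).

Let Fphi := map_alg_hom F phi.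

Lemma map_ind_lact :
  ind_lact Fphi = fmap F (ind_lact phi) ∘ phi2 F (acar R) (acar S).
Proof. by rewrite /ind_lact /= -compA phi2_nat1 compA -fmap_comp. Qed.

(** [F] preserves the coequalizer defining [M ⊗_R S]; it is reindexed along [phi2] on the target of
    the parallel pair and along two successive [phi2] on its source. The actions match by naturality
    of [phi2], and the associator by [phi2_assoc]. *)
Lemma map_ind_mapP (M : RightModule R) :
  is_coequalizer (ract (map_rmod F M) ⊠ idm (F (acar S)))
    ((idm (F (rcar M)) ⊠ ind_lact Fphi)
       ∘ assoc (F (rcar M)) (F (acar R)) (F (acar S)))
    (fmap F (ind_map coeqC phi M) ∘ phi2 F (rcar M) (acar S)).
Proof.
apply: (coequalizer_reindex (d := phi2 F (rcar M ⊗ acar R) (acar S)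
          ∘ (phi2 F (rcar M) (acar R) ⊠ idm (F (acar S))))
          _ _ _ _ (F_coeq (ind_mapP coeqC phi M))).
- move=> Z u v; apply: iso_epi.
  by apply: is_iso_comp; [|apply: is_iso_tens1]; apply: phi2_iso.
- exact: phi2_iso.
- by rewrite /= tens_comp1 !compA phi2_nat1.
- rewrite fmap_comp -!compA (compA (fmap F (assoc _ _ _))) phi2_assoc.
  by rewrite map_ind_lact tens_1comp !compA phi2_nat2.
Qed.

Definition ind_compar_car (M : RightModule R) :
  Hom (ind_car coeqD Fphi (map_rmod F M)) (F (ind_car coeqC phi M)) :=
  coeq_desc (ind_mapP coeqD Fphi (map_rmod F M)) (proj1 (map_ind_mapP M)).

Lemma ind_compar_carE (M : RightModule R) :
  ind_compar_car M ∘ ind_map coeqD Fphi (map_rmod F M)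
  = fmap F (ind_map coeqC phi M) ∘ phi2 F (rcar M) (acar S).
Proof. exact: (coeq_descK (ind_mapP coeqD Fphi (map_rmod F M))). Qed.

Lemma ind_compar_car_iso (M : RightModule R) : is_iso (ind_compar_car M).
Proof.
have qP := ind_mapP coeqD Fphi (map_rmod F M).
exact: (coequalizer_iso qP (map_ind_mapP M) (ind_compar_carE M)).
Qed.

(** As [F(S)] is coflat, the coequalizer map tensored with [F(S)] is epi. After precomposing with
    it, both sides are induced by the multiplication of [S], and agree by the associativity axiom of
    [phi2]. *)
Lemma ind_compar_act (M : RightModule R) :
  ind_compar_car M ∘ ract (ind_ob coeqD Fphi coflatFS (map_rmod F M))
  = ract (map_rmod F (ind_ob coeqC phi coflatS M))
    ∘ (ind_compar_car M ⊠ idm (F (acar S))).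
Proof.
apply: (ind_map_tens_epi (coeqC := coeqD) (phi := Fphi) coflatFS).
have actE := ind_actE coeqD Fphi coflatFS (map_rmod F M).
have carE := ind_compar_carE M.
(* Simplification exposes the carriers and actions of the image algebras and modules as images under
   [F], so that the equations match the goal syntactically. *)
rewrite /= in actE carE *.
rewrite -!compA actE -tens_comp1 carE (compA (ind_compar_car M)) carE.
rewrite tens_comp1 (compA (phi2 F _ _)) phi2_nat1 !compA.
rewrite -fmap_comp ind_actE !fmap_comp -!compA; congr (_ ∘ _).
rewrite /= (compA (fmap F (assoc _ _ _))) phi2_assoc tens_1comp !compA.
by rewrite phi2_nat2.
Qed.

Definition ind_compar (M : RightModCat R) :
  Hom (induction coeqD Fphi coflatFS (map_rmod_functor F R M))
      (map_rmod_functor F S (induction coeqC phi coflatS M)) :=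
  Build_RightModuleHom (M := ind_ob coeqD Fphi coflatFS (map_rmod F M))
    (N := map_rmod F (ind_ob coeqC phi coflatS M)) (ind_compar_act M).

Lemma ind_compar_iso (M : RightModCat R) : is_iso (ind_compar M).
Proof. exact/rmod_is_iso/ind_compar_car_iso. Qed.

(** Both sides are determined by their composites with the coequalizer map, where the claim becomes
    naturality of [phi2] in its first argument. *)
Lemma ind_compar_nat (M N : RightModCat R) (f : Hom M N) :
  ind_compar N ∘ fmap (induction coeqD Fphi coflatFS)
                   (fmap (map_rmod_functor F R) f)
  = fmap (map_rmod_functor F S) (fmap (induction coeqC phi coflatS) f)
    ∘ ind_compar M.
Proof.
apply: rhom_inj; apply: (coeq_epi (ind_mapP coeqD Fphi (map_rmod F M))).
have homE := ind_homE coeqD Fphi (fmap (map_rmod_functor F R) f).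
have carE := ind_compar_carE.
rewrite /= in homE carE *.
rewrite -!compA homE compA !carE (compA (fmap F _)) -fmap_comp.
by rewrite ind_homE fmap_comp -!compA phi2_nat1.
Qed.

End InductionComparison.

Theorem proposition3p29 (C D : MonoidalCategory)
    (coeqC : has_coequalizers C) (coeqD : has_coequalizers D)
    (coflatC : forall X : C, coflat X) (coflatD : forall X : D, coflat X)
    (R S : Algebra C) (phi : AlgebraHom R S)
    (F : StrongMonoidalFunctor C D)
    (F_ff : fully_faithful F) (F_coeq : preserves_coequalizers F) :
  let phi_star := induction coeqC phi (coflatC (acar S)) in
  let Fphi_star :=
    induction coeqD (map_alg_hom F phi) (coflatD (acar (map_alg F S))) in
  (semiseparable Fphi_star -> semiseparable phi_star) /\
  (separable Fphi_star -> separable phi_star) /\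
  (naturally_full Fphi_star -> naturally_full phi_star).
Proof.
move=> phi_star Fphi_star.
pose theta := ind_compar coeqC coeqD phi F_coeq (coflatC (acar S))
                (coflatD (acar (map_alg F S))).
(* Invertibility is an existence statement for each [M]; choosing inverses gives the family
   [theta']. *)
have theta_inv M := constructive_indefinite_description _
  (ind_compar_iso coeqC coeqD phi F_coeq (coflatC (acar S))
     (coflatD (acar (map_alg F S))) M).
pose theta' M := proj1_sig (theta_inv M).
have thetaK M : theta' M ∘ theta M = idm _ := proj1 (proj2_sig (theta_inv M)).
have theta'K M : theta M ∘ theta' M = idm _ := proj2 (proj2_sig (theta_inv M)).
have theta_nat := ind_compar_nat coeqC coeqD phi F_coeq (coflatC (acar S))
                    (coflatD (acar (map_alg F S))).
have H_ff := map_rmod_ff R F_ff.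
have K_faithful := map_rmod_faithful (A := S) (proj2 F_ff).
split; last split.
- exact: (semiseparable_transfer H_ff K_faithful thetaK theta'K theta_nat).
- exact: (separable_transfer H_ff thetaK theta'K theta_nat).
- exact: (naturally_full_transfer H_ff K_faithful thetaK theta'K theta_nat).
Qed.
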